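(* Let $G$ be a finite group and let $k\ge 3$ be an integer. Assume that $V_k<G_k$, that $G'/V_k$ is abelian, and that $G_i$ is $H_1$ for all $i=3,\dots,k$. Then $D_k=D_3$.
   Context: For a finite group $G$, the lower central series is $G_1=G$, $G_2=G'=[G,G]$, $G_i=[G_{i-1},G]$ for $i\ge 3$. Let $\mathrm{nl}(G)=\{\chi\in\mathrm{Irr}(G)\mid \chi(1)\ne 1\}$ be the set of nonlinear irreducible complex characters. The vanishing-off subgroup is $V(G)=\langle g\in G\mid \text{there exists }\chi\in\mathrm{nl}(G)\text{ with }\chi(g)\neq 0\rangle$. Define $V_1=V_1(G)=V(G)$ and $V_i=V_i(G)=[V_{i-1},G]$ for $i\ge 2$. It is known that $G_{i+1}\le V_i\le G_i$, so the quotients below make sense. The symbol $<$ denotes proper containment. For $i\ge 3$ define subgroups $Y_i=Y_i(G)$ and $D_i=D_i(G)$, both containing $V_i$, by $Y_i/V_i=Z(G/V_i)$ and $D_i/V_i=C_{G/V_i}(G_{i-1}/V_i)$. For $k\ge 3$, we say that ''$G_k$ is $H_1$'' if for every normal subgroup $N$ of $G$ with $V_k\le N<G_k$ we have $V_{k-1}/N=(G_{k-1}/N)\cap Y_k(G/N)$, where $V_{k-1}=V_{k-1}(G)$ and $Y_k(G/N)$ is the subgroup $Y_k$ of the group $G/N$. *)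

(* Defs.v *)
From HB Require Import structures.
From mathcomp Require Import all_boot all_order all_algebra.
From mathcomp Require Import all_fingroup all_solvable all_field all_character.

Set Implicit Arguments.
Unset Strict Implicit.
Unset Printing Implicit Defensive.

Import GroupScope GRing.Theory.
Local Open Scope group_scope.

(* The lower central series G_i is the library's 'L_i(G), with 'L_1(G) = G.
   Irreducible complex characters are the library's irr G, with values in
   algC: every irreducible complex representation of a finite group is
   realizable over the algebraic numbers. *)

(* Indices of the nonlinear irreducible characters of G. *)
Definition nl (gT : finGroupType) (G : {group gT}) : {set Iirr G} :=
  [set i | ('chi[G]_i 1%g != 1)%R].

Definition vanishing_off (gT : finGroupType) (G : {group gT}) : {set gT} :=
  <<[set g in G | [exists i in nl G, ('chi[G]_i g != 0)%R]]>>.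

(* Numbered as 'L_i(G): V_1 = V(G) and V_i = [V_(i-1), G] for i >= 2
   (the value at i = 0 is irrelevant). *)
Definition vseries (i : nat) (gT : finGroupType) (G : {group gT}) : {set gT} :=
  iter i.-1 (fun B => [~: B, G]) (vanishing_off G).

(* As V_i <| G, the preimages below under the projection G -> G / V_i are
   subgroups of G containing V_i. *)
Definition Yseries (i : nat) (gT : finGroupType) (G : {group gT}) : {set gT} :=
  coset (vseries i G) @*^-1 'Z(G / vseries i G).

Definition Dseries (i : nat) (gT : finGroupType) (G : {group gT}) : {set gT} :=
  coset (vseries i G) @*^-1
    'C_(G / vseries i G)('L_(i.-1)(G) / vseries i G).

(* "G_k is H_1", meant for k >= 3. *)
Definition is_H1 (k : nat) (gT : finGroupType) (G : {group gT}) : Prop :=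
  forall N : {group gT},
    N <| G -> vseries k G \subset N -> N \proper 'L_k(G) ->
    vseries k.-1 G / N = ('L_(k.-1)(G) / N) :&: Yseries k (G / N)%G.

Lemma vseries1 (gT : finGroupType) (G : {group gT}) :
  vseries 1 G = vanishing_off G.
Proof. by []. Qed.

Lemma vseriesS (i : nat) (gT : finGroupType) (G : {group gT}) :
  0 < i -> vseries i.+1 G = [~: vseries i G, G].
Proof. by case: i. Qed.

Lemma group_set_vseries (i : nat) (gT : finGroupType) (G : {group gT}) :
  group_set (vseries i G).
Proof. by rewrite /vseries; case: i.-1 => [|n]; apply: groupP. Qed.

Canonical vanishing_off_group (gT : finGroupType) (G : {group gT}) :=
  Eval hnf in [group of vanishing_off G].

Canonical vseries_group (i : nat) (gT : finGroupType) (G : {group gT}) :=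
  Group (group_set_vseries i G).

Canonical Yseries_group (i : nat) (gT : finGroupType) (G : {group gT}) :=
  Eval hnf in [group of Yseries i G].

Canonical Dseries_group (i : nat) (gT : finGroupType) (G : {group gT}) :=
  Eval hnf in [group of Dseries i G].

(* Main.v *)
Require Import Defs.
From HB Require Import structures.
From mathcomp Require Import all_boot all_order all_algebra.
From mathcomp Require Import all_fingroup all_solvable all_field all_character.

Set Implicit Arguments.
Unset Strict Implicit.
Unset Printing Implicit Defensive.

Import GroupScope GRing.Theory.
Local Open Scope group_scope.

(* It suffices to see that D_i = D_(i+1) for 3 <= i < k. Both inclusions are
   the three subgroups lemma modulo V_(i+1) applied to G, G_(i-1) and D, where
   [G, D, G_(i-1)] <= [G', G'] <= V_(i+1): hence [D, G_(i-1), G] <= V_(i+1) if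
   and only if [D, G_i] <= V_(i+1). The latter says D <= D_(i+1). As
   V_(i+1) = [V_i, G], the former follows from [D, G_(i-1)] <= V_i, that is from
   D <= D_i; conversely it implies it, because by H_1 for G_(i+1) with
   N = V_(i+1), an element of G_i that centralizes G modulo V_(i+1) is in V_i. *)

(** In [G / N] the containments become trivial commutators, and the usual three subgroups lemma
    applies. *)
Lemma three_subgroup_mod (gT : finGroupType) (N G A B C : {group gT}) :
    N <| G -> A \subset G -> B \subset G -> C \subset G ->
  [~: A, B, C] \subset N -> [~: B, C, A] \subset N -> [~: C, A, B] \subset N.
Proof.
case/andP=> _ nNG sAG sBG sCG.
have [nNA nNB nNC] : [/\ A \subset 'N(N), B \subset 'N(N) & C \subset 'N(N)].
  by split; apply: subset_trans nNG.
have modE (X Y Z : {group gT}) : X \subset 'N(N) -> Y \subset 'N(N) ->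
    Z \subset 'N(N) ->
  ([~: X, Y, Z] \subset N) = ([~: X / N, Y / N, Z / N] == 1).
  move=> nNX nNY nNZ; have nNXY : [~: X, Y] \subset 'N(N) by rewrite comm_subG.
  by rewrite -quotient_sub1 ?comm_subG // !quotientR // subG1.
rewrite !modE // => /eqP ABC1 /eqP BCA1; apply/eqP.
exact: three_subgroup ABC1 BCA1.
Qed.

(** Characters are class functions, so the generating set is stable under conjugation by [G]. *)
Lemma vanishing_off_normal (gT : finGroupType) (G : {group gT}) :
  vanishing_off G <| G.
Proof.
rewrite /normal gen_subG; apply/andP; split.
  by apply/subsetP=> x; rewrite inE => /andP[].
apply: norms_gen; apply/subsetP=> x Gx; rewrite inE.
apply/subsetP=> _ /imsetP[y + ->]; rewrite !inE => /andP[Gy /existsP[i nz_iy]].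
by rewrite groupJ //=; apply/existsP; exists i; rewrite cfunJ.
Qed.

Lemma vseries_normal (gT : finGroupType) (G : {group gT}) i :
  vseries i G <| G.
Proof.
(* Indices 0 and 1 both give [vanishing_off G]. *)
elim: i => [|[|i] IHi]; [exact: vanishing_off_normal.. |].
rewrite vseriesS // /normal normsR ?normG ?normal_norm // andbT.
by rewrite comm_subG ?normal_sub.
Qed.

Lemma vseries_sub_lcn (gT : finGroupType) (G : {group gT}) i :
  vseries i.+1 G \subset 'L_i.+1(G).
Proof.
elim: i => [|i IHi]; first by rewrite lcn1 normal_sub ?vseries_normal.
by rewrite vseriesS // lcnSn commSg.
Qed.

Lemma vseriesS_sub (gT : finGroupType) (G : {group gT}) i :
  vseries i.+1 G \subset vseries i G.
Proof.
case: i => [|i]; first exact: subxx.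
by rewrite vseriesS // commg_subl normal_norm ?vseries_normal.
Qed.

(** Equality of the two series at one index passes to the next on taking commutators with [G]. The
    contrapositive lets the induction on [k] descend. *)
Lemma vseriesS_proper (gT : finGroupType) (G : {group gT}) i :
  vseries i.+2 G \proper 'L_i.+2(G) -> vseries i.+1 G \proper 'L_i.+1(G).
Proof.
apply: contraTT; rewrite !properE vseries_sub_lcn negbK => sLV.
by rewrite vseriesS // lcnSn (commSg _ sLV) andbF.
Qed.

Lemma sub_Dseries (gT : finGroupType) (G : {group gT}) i (A : {group gT}) :
    A \subset G ->
  (A \subset Dseries i G) = ([~: A, 'L_i.-1(G)] \subset vseries i G).
Proof.
move=> sAG; have nVG := normal_norm (vseries_normal G i).
have nVA := subset_trans sAG nVG.
have nVL := subset_trans (lcn_sub i.-1 G) nVG.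
by rewrite -sub_quotient_pre // subsetI quotientS // quotient_cents2.
Qed.

Lemma Dseries_sub (gT : finGroupType) (G : {group gT}) i :
  Dseries i G \subset G.
Proof.
have nsVG := vseries_normal G i.
by rewrite /Dseries -(quotientGK nsVG) morphpreS // quotientGK // subsetIl.
Qed.

Lemma H1_sub_vseries (gT : finGroupType) (G : {group gT}) i (A : {group gT}) :
    is_H1 i.+1 G -> vseries i.+1 G \proper 'L_i.+1(G) -> A \subset 'L_i(G) ->
  [~: A, G] \subset vseries i.+1 G -> A \subset vseries i G.
Proof.
move=> H1i prV sAL sAGV; have nsVG := vseries_normal G i.+1.
have nVG := normal_norm nsVG.
have sAG := subset_trans sAL (lcn_sub i G).
have nVA := subset_trans sAG nVG.
rewrite -(quotientSGK nVA (vseriesS_sub G i)).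
have /= -> := H1i _ nsVG (subxx _) prV.
rewrite subsetI quotientS //=.
(* What remains is to place the image of [A] in Y_(i+1)(G / N) for N = V_(i+1). That image is
   central in G / N, hence stays central modulo V_(i+1)(G / N). *)
have cAG : A / vseries i.+1 G \subset 'Z(G / vseries i.+1 G).
  by rewrite subsetI quotientS // quotient_cents2.
have /andP[_ nWG] := vseries_normal (G / vseries_group i.+1 G) i.+1.
have sZG := center_sub (G / vseries_group i.+1 G).
rewrite -sub_quotient_pre ?(subset_trans cAG) ?(subset_trans sZG) //.
apply: subset_trans (quotientS _ cAG) _.
rewrite subsetI quotientS //=.
by apply: quotient_cents; apply: subsetIr.
Qed.

Lemma Dseries_step (gT : finGroupType) (G : {group gT}) i :
    2 < i -> vseries i.+1 G \proper 'L_i.+1(G) ->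
    abelian (G^`(1) / vseries i.+1 G) -> is_H1 i.+1 G ->
  Dseries i.+1 G = Dseries i G.
Proof.
(* From here [i] is two less than in the statement, and [i_gt0] amounts to 0 < i, so that
   ['L_i.+1(G)] lies in G'. *)
case: i => [|[|i]] // i_gt0 prV abG' H1i.
have nsVG := vseries_normal G i.+3.
have sG'V : [~: G^`(1), G^`(1)] \subset vseries i.+3 G.
  rewrite -quotient_cents2 //; apply: subset_trans (normal_norm nsVG).
    exact: der_sub.
  exact: der_sub.
have sLG' : 'L_i.+1(G) \subset G^`(1).
  case: i i_gt0 {prV abG' H1i nsVG sG'V} => // i _.
  by rewrite lcnSn derg1 commSg ?lcn_sub.
have sGDL (D : {group gT}) :
    D \subset G -> [~: G, D, 'L_i.+1(G)] \subset vseries i.+3 G.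
  by move=> sDG; apply: subset_trans (commgSS _ sLG') sG'V; rewrite commgS.
apply/eqP; rewrite eqEsubset; apply/andP; split.
  rewrite sub_Dseries ?Dseries_sub //.
  apply: (H1_sub_vseries H1i prV).
    by rewrite /= commGC lcnSn commgS ?Dseries_sub.
  (* Here A = G_(i+1), B = G and C = D_(i+3); what is left is [G_(i+2), D_(i+3)] <= V_(i+3). *)
  apply: (three_subgroup_mod nsVG) (sGDL _ _); rewrite ?lcn_sub ?Dseries_sub //.
  by rewrite -lcnSn commGC -(sub_Dseries i.+3) ?Dseries_sub.
rewrite sub_Dseries ?Dseries_sub //= lcnSn commGC.
(* Now A = G, B = D_(i+2) and C = G_(i+1). *)
apply: (three_subgroup_mod nsVG) (sGDL _ _) _; rewrite ?lcn_sub ?Dseries_sub //.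
by rewrite /= vseriesS // commSg // -(sub_Dseries i.+2) ?Dseries_sub.
Qed.

Theorem theorem1 (gT : finGroupType) (G : {group gT}) (k : nat)
    (k_ge3 : 3 <= k)
    (Vk_proper : vseries k G \proper 'L_k(G))
    (quo_abelian : abelian (G^`(1) / vseries k G))
    (H1 : forall i : nat, 3 <= i <= k -> is_H1 i G) :
  Dseries k G = Dseries 3 G.
Proof.
elim: k k_ge3 Vk_proper quo_abelian H1 => // -[//|k] IHk.
rewrite leq_eqVlt => /predU1P[<- //|k_ge3] prV abG' H1.
have nVG' i : G^`(1) \subset 'N(vseries i G).
  exact: subset_trans (der_sub 1 G) (normal_norm (vseries_normal G i)).
have H1k i : 2 < i <= k.+1 -> is_H1 i G.
  by case/andP=> i_gt2 le_ik; apply: H1; rewrite i_gt2 leqW.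
(* Commutativity survives the passage to the larger subgroup V_(k+1). *)
have abV : abelian (G^`(1) / vseries k.+1 G).
  move: abG'; rewrite /abelian !(quotient_cents2 (nVG' _) (nVG' _)) => sG'V.
  exact: subset_trans sG'V (vseriesS_sub G k.+1).
rewrite -(IHk k_ge3 (vseriesS_proper prV) abV H1k).
by apply: Dseries_step prV abG' _; last by apply: H1; rewrite leqnn andbT ltnW.
Qed.
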